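(* Let $\mathcal{I}$ be an ideal on $\mathbb{N}$ that is invariant under translations. Consider the optimal control problem $$x_{n+1}=f(x_n,u_n),\quad x_1=\zeta^0,\quad u_n\in U\qquad (n\in\mathbb{N}),$$ $$J_{\mathcal{I}}(x)=\mathcal{I}\text{-}\liminf \phi(x_n)\to\max,$$ with data $f,U,\phi,\zeta^0,C$ as in the context. Suppose that the following three conditions hold: (1) the optimal stationary point is unique, i.e. $M^\star=\{\zeta^\star\}$; (2) there exists a process $\langle u^\star,x^\star\rangle$ such that $\Gamma_{\mathcal{I}}(x^\star)\subset D^\star$; (3) there exists a continuous function $P\colon\mathbb{R}^m\to\mathbb{R}$ such that $P(f(x_0,u_0))<P(x_0)$ for all $x_0\in D^\star\setminus M^\star$ and $u_0\in U$, and $P(f(x_0,u_0))\le P(x_0)$ for all $x_0\in D^\star$ and $u_0\in U$. Let $\langle u^{opt},x^{opt}\rangle$ be an optimal process in this problem. Then $x^{opt}$ is $\mathcal{I}$-convergent to $\zeta^\star$.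
   Context: Ideals. $\mathbb{N}=\{1,2,\ldots\}$. An ideal on $\mathbb{N}$ is a family $\mathcal{I}\subset\mathcal{P}(\mathbb{N})$ with $\emptyset\in\mathcal{I}$, closed under subsets and under finite unions; all ideals are assumed proper ($\mathcal{I}\ne\mathcal{P}(\mathbb{N})$) and to contain all finite subsets of $\mathbb{N}$. $\mathcal{I}$ is invariant under translations if for every $A\in\mathcal{I}$ and $i\in\mathbb{Z}$ the set $A+i=\{a+i: a\in A\}\cap\mathbb{N}$ belongs to $\mathcal{I}$. $\|\cdot\|$ is the Euclidean norm. A sequence $(x_n)_{n\in\mathbb{N}}$ in $\mathbb{R}^m$ is $\mathcal{I}$-convergent to $a\in\mathbb{R}^m$ if $\{n:\|x_n-a\|\ge\varepsilon\}\in\mathcal{I}$ for every $\varepsilon>0$. A point $a$ is an $\mathcal{I}$-cluster point of $x=(x_n)$ if $\{n:\|x_n-a\|<\varepsilon\}\notin\mathcal{I}$ for every $\varepsilon>0$; $\Gamma_{\mathcal{I}}(x)$ is the set of all $\mathcal{I}$-cluster points of $x$. For a real sequence $y=(y_n)$, $\mathcal{I}\text{-}\liminf y=\sup\{y_0\in\mathbb{R}:\{n\in\mathbb{N}: y_n<y_0\}\in\mathcal{I}\}$. Control problem. $f\colon\mathbb{R}^m\times\mathbb{R}^t\to\mathbb{R}^m$ is continuous, $U\subset\mathbb{R}^t$ is compact, $\phi\colon\mathbb{R}^m\to\mathbb{R}$ is continuous, and $\zeta^0\in\mathbb{R}^m$ is a fixed initial point. A process is a pair $\langle u,x\rangle$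 of sequences $u=(u_n)$, $x=(x_n)$ with $x_1=\zeta^0$, $u_n\in U$ and $x_{n+1}=f(x_n,u_n)$ for all $n\in\mathbb{N}$; $x$ is called a trajectory. $C\subset\mathbb{R}^m$ is a compact set such that $x_n\in C$ for all $n$ and all trajectories $x$. A process is optimal if it maximizes $J_{\mathcal{I}}$ among all processes. Stationary points. $M=\{\zeta\in\mathbb{R}^m: f(\zeta,u_0)=\zeta\text{ for some }u_0\in U\}$ is the set of stationary points. $\phi^\star=\max_{\zeta\in M}\phi(\zeta)$, and $M^\star=\{\zeta\in M:\phi(\zeta)=\phi^\star\}$ is the set of optimal stationary points; it is assumed that the maximum is attained, i.e. $M^\star\neq\emptyset$, and that $M^\star\subset C$. $D^\star=\{\zeta\in C:\phi(\zeta)\ge\phi^\star\}$. *)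

(* Defs.v *)
From HB Require Import structures.
From mathcomp Require Import all_boot all_order all_algebra.
From mathcomp Require Import all_classical all_reals all_analysis.

Set Implicit Arguments.
Unset Strict Implicit.
Unset Printing Implicit Defensive.

Import Order.TTheory GRing.Theory Num.Theory.
Import numFieldNormedType.Exports.

Local Open Scope classical_set_scope.
Local Open Scope ring_scope.

(* The index set {1, 2, ...} is represented by nat through n |-> n - 1, so the
   first term of a sequence x is x 0.  The relabelling commutes with
   A |-> (A + i) intersected with the index set, hence with translation
   invariance. *)

Record admissible_ideal (I : set (set nat)) : Prop := AdmissibleIdeal {
  ideal_set0 : I set0 ;
  ideal_sub : forall A B : set nat, A `<=` B -> I B -> I A ;
  ideal_setU : forall A B : set nat, I A -> I B -> I (A `|` B) ;
  ideal_neqT : I <> setT ;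
  ideal_finite : forall A : set nat, finite_set A -> I A
}.

(* Only the nonnegative elements of A + i are kept, as n ranges over nat. *)
Definition translate (A : set nat) (i : int) : set nat :=
  [set n : nat | exists2 a : nat, A a & n%:Z = a%:Z + i].

Definition translation_invariant (I : set (set nat)) : Prop :=
  forall (A : set nat) (i : int), I A -> I (translate A i).

(* The library norm on 'rV[R]_m is the sup norm. *)
Definition euclidean_norm (R : realType) (m : nat) (v : 'rV[R]_m) : R :=
  Num.sqrt (\sum_(i < m) (v ord0 i) ^+ 2).

Definition ideal_cvg (R : realType) (m : nat) (I : set (set nat))
    (x : nat -> 'rV[R]_m) (a : 'rV[R]_m) : Prop :=
  forall e : R, 0 < e -> I [set n | e <= euclidean_norm (x n - a)].

Definition ideal_cluster (R : realType) (m : nat) (I : set (set nat))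
    (x : nat -> 'rV[R]_m) : set 'rV[R]_m :=
  [set a | forall e : R, 0 < e -> ~ I [set n | euclidean_norm (x n - a) < e]].

(* The supremum is taken in the extended reals, as the set of lower levels may
   be empty or unbounded for an arbitrary real sequence. *)
Definition ideal_liminf (R : realType) (I : set (set nat)) (y : nat -> R)
    : \bar R :=
  ereal_sup [set y0%:E | y0 in [set y0 : R | I [set n | y n < y0]]].

Section ControlProblem.
Context (R : realType) (m t : nat).
Variables (f : 'rV[R]_m * 'rV[R]_t -> 'rV[R]_m) (U : set 'rV[R]_t).
Variables (phi : 'rV[R]_m -> R) (zeta0 : 'rV[R]_m).

Definition process (u : nat -> 'rV[R]_t) (x : nat -> 'rV[R]_m) : Prop :=
  [/\ x 0%N = zeta0, forall n, U (u n) & forall n, x n.+1 = f (x n, u n)].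

Definition objective (I : set (set nat)) (x : nat -> 'rV[R]_m) : \bar R :=
  ideal_liminf I (fun n => phi (x n)).

Definition optimal_process (I : set (set nat))
    (u : nat -> 'rV[R]_t) (x : nat -> 'rV[R]_m) : Prop :=
  process u x /\
  forall u' x', process u' x' -> (objective I x' <= objective I x)%E.

Definition stationary : set 'rV[R]_m :=
  [set z | exists2 u0, U u0 & f (z, u0) = z].

Definition is_stationary_max (phistar : R) : Prop :=
  (phi @` stationary) phistar /\ ubound (phi @` stationary) phistar.

Definition optimal_stationary (phistar : R) : set 'rV[R]_m :=
  [set z | stationary z /\ phi z = phistar].

Definition superlevel (C : set 'rV[R]_m) (phistar : R) : set 'rV[R]_m :=
  [set z | C z /\ phistar <= phi z].

End ControlProblem.

(* Main.v *)
Require Import Defs.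
From HB Require Import structures.
From mathcomp Require Import all_boot all_order all_algebra.
From mathcomp Require Import all_classical all_reals all_analysis.

Import Order.TTheory GRing.Theory Num.Theory.
Import numFieldNormedType.Exports.

Local Open Scope classical_set_scope.
Local Open Scope ring_scope.

(** Let K be the set of cluster points of x^opt.  By translation invariance and
    compactness of C and U, every a in K has some u in U with f(a,u) in K, and
    every b in K equals f(a,u) for some a in K and u in U.  Comparing x^opt with
    the process of hypothesis (2) gives K inside D^star.  A minimizer a of P on
    K cannot satisfy P(f(a,u)) < P(a) with f(a,u) in K, hence it is zeta^star; a
    maximizer b = f(a,u) forces P(a) = P(b), hence a = zeta^star is a maximizer
    as well.  So P is constant on K, every point of K is a minimizer, and
    K = {zeta^star}. *)

(** If [V] were not in [F], restricting [F] to the complement of [V] would give a proper filter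
    containing [K]. Its cluster point in [K] is also one of [F], so [V] would be a neighbourhood of
    a point that its complement clusters at. *)
Lemma near_of_compact_cluster (T : topologicalType) (F : set_system T)
    {FF : ProperFilter F} (K V : set T) :
  compact K -> F K -> (forall c, K c -> cluster F c -> nbhs c V) -> F V.
Proof.
move=> cK FK hV; apply: contrapT => nFV.
have PG : ProperFilter (within (~` V) F).
  apply: Build_ProperFilter; rewrite /within /= => FVC; apply: nFV.
  by apply: filterS FVC => z hz; apply: contrapT => /hz.
have GK : within (~` V) F K by apply: filterS FK => z Kz _.
have [c [Kc clc]] := cK _ PG GK.
have clFc : cluster F c by apply: cvg_cluster clc; exact: cvg_within.
by have [z []] := clc _ _ (withinT (~` V) _) (hV _ Kc clFc).
Qed.

Lemma cluster_image_lift (Z Y : topologicalType) (F : set_system Z)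
    {FF : ProperFilter F} (K : set Z) (g : Z -> Y) (b : Y) :
  hausdorff_space Y -> continuous g -> compact K -> F K ->
  cluster (g @ F) b -> exists c, [/\ K c, cluster F c & g c = b].
Proof.
move=> hY cg cK FK clb.
pose G := filter_from [set AV : set Z * set Y | F AV.1 /\ nbhs b AV.2]
                      (fun AV => AV.1 `&` g @^-1` AV.2).
have PG : ProperFilter G.
  apply: filter_from_proper; last first.
    move=> [A V] [/= FA bV].
    have /(clb _ V) : (g @ F) (g @` A).
      by apply: (filterS (P := A)) FA => z Az; exists z.
    by move=> /(_ bV) [_ [[z Az <-] Vz]]; exists z.
  apply: filter_from_filter.
    by exists (setT, setT); split; exact: filterT.
  move=> [A V] [B W] [/= FA bV] [/= FB bW].
  exists (A `&` B, V `&` W) => /=; first by split; exact: filterI.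
  by move=> z [[Az Bz] [Vz Wz]].
have sFG : F `<=` G.
  move=> A FA; exists (A, setT); first by split => //; exact: filterT.
  by move=> z [].
have [c [Kc clc]] := cK _ PG (sFG _ FK).
exists c; split => //; first exact: cvg_cluster clc.
apply: hY => A B cA bB.
have GB : G (g @^-1` B).
  by exists (setT, B); [split=> //; exact: filterT | move=> z []].
have [z [Bz Az]] := clc _ _ GB (cg c _ cA).
by exists (g z).
Qed.

Lemma closed_cluster (T : topologicalType) (F : set_system T) :
  closed (cluster F).
Proof. by rewrite clusterE; apply: closed_bigI => A _; exact: closed_closure. Qed.

(** Passing to complements makes filter compactness available for sequences modulo [I]. *)
Definition dual_filter (I : set (set nat)) : set_system nat :=
  [set A | I (~` A)].

Section DualFilter.
Context (I : set (set nat)) (hI : admissible_ideal I).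

Lemma dual_filter_proper : ProperFilter (dual_filter I).
Proof.
apply: Build_ProperFilter.
  rewrite /dual_filter /= setC0 => IT; apply: (ideal_neqT hI).
  by apply/seteqP; split => // A _; exact: ideal_sub hI _ _ (@subsetT _ A) IT.
split; rewrite /dual_filter /mkset.
- by rewrite setCT; exact: ideal_set0.
- by move=> A B IA IB; rewrite setCI; exact: ideal_setU.
- by move=> A B AB; apply: (ideal_sub hI); exact: subsetC.
Qed.

(** Shifting complements by 1 misses only the index 0, which is absorbed as a finite set; shifting
    by -1 gives the converse. *)
Lemma dual_filterS : translation_invariant I ->
  forall A, dual_filter I [set n | A n.+1] <-> dual_filter I A.
Proof.
move=> hinv A; split=> IA.
- apply: (ideal_sub hI (B := [set 0%N] `|` translate (~` [set n | A n.+1]) 1)).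
    move=> [|n] nA; [by left|right]; exists n => //.
    by rewrite -PoszD addn1.
  by apply: (ideal_setU hI); [exact: ideal_finite | exact: hinv].
- apply: (ideal_sub hI) (hinv _ (-1) IA) => n nA.
  by exists n.+1 => //; rewrite -addn1 PoszD addrK.
Qed.

Lemma fmap_dual_filterS (T : Type) (x : nat -> T) : translation_invariant I ->
  (fun n => x n.+1) @ dual_filter I = x @ dual_filter I.
Proof.
by move=> hinv; apply/seteqP; split => A /(dual_filterS hinv (x @^-1` A)).
Qed.

End DualFilter.

Section Euclidean.
Context (R : realType) (m : nat).

Lemma continuous_euclidean_norm (a : 'rV[R]_m) :
  continuous (fun v : 'rV[R]_m => euclidean_norm (v - a)).
Proof.
have csq i : continuous (fun v : 'rV[R]_m => (v - a) ord0 i ^+ 2).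
  move=> v; have cB : (w - a) @[w --> v] --> v - a.
    exact: (cvgB cvg_id (cvg_cst _)).
  have ccoord := cvg_comp _ _ cB (@coord_continuous R 1 m ord0 i (v - a)).
  exact: (cvg_comp _ _ ccoord (@exprn_continuous R 2 _)).
have csum : continuous (fun v : 'rV[R]_m => \sum_(i < m) (v - a) ord0 i ^+ 2).
  by apply: continuous_big => [|i _]; [exact: add_continuous | exact: csq].
by move=> v; exact: (cvg_comp _ _ (csum v) (@sqrt_continuous R _)).
Qed.

(** Links the Euclidean norm to the ambient sup-norm topology. *)
Lemma nbhs_euclidean_ball (a : 'rV[R]_m) (e : R) : 0 < e ->
  nbhs a [set v | euclidean_norm (v - a) < e].
Proof.
move=> e0; have ae : euclidean_norm (a - a) < e.
  rewrite subrr /euclidean_norm big1 ?sqrtr0// => i _.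
  by rewrite mxE expr0n.
exact: (@continuous_euclidean_norm a a _ (lt_nbhsl ae)).
Qed.

Lemma cluster_ideal_cluster (I : set (set nat)) (x : nat -> 'rV[R]_m) :
  cluster (x @ dual_filter I) `<=` ideal_cluster I x.
Proof.
move=> a cla e e0 Ie.
have FA : (x @ dual_filter I) [set v | e <= euclidean_norm (v - a)].
  rewrite /= /nbhs /= /dual_filter /=; move: Ie; congr I.
  by apply/seteqP; split => n /=; rewrite ltNge => /negP.
have [v [/= ev ve]] := cla _ _ FA (nbhs_euclidean_ball _ _ e0).
by move: ve; rewrite ltNge ev.
Qed.

End Euclidean.

Theorem theorem14 (R : realType) (m t : nat) (I : set (set nat))
  (f : 'rV[R]_m * 'rV[R]_t -> 'rV[R]_m) (U : set 'rV[R]_t)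
  (phi : 'rV[R]_m -> R) (zeta0 : 'rV[R]_m) (C : set 'rV[R]_m)
  (phistar : R) (zetastar : 'rV[R]_m)
  (uopt : nat -> 'rV[R]_t) (xopt : nat -> 'rV[R]_m)
  (hI : admissible_ideal I) (hIinv : translation_invariant I)
  (hf : continuous f) (hU : compact U) (hphi : continuous phi)
  (hC : compact C)
  (hCtraj : forall u x, process f U zeta0 u x -> forall n, C (x n))
  (hphistar : is_stationary_max f U phi phistar)
  (hMC : optimal_stationary f U phi phistar `<=` C)
  (h1 : optimal_stationary f U phi phistar = [set zetastar])
  (h2 : exists u x, process f U zeta0 u x /\
          ideal_cluster I x `<=` superlevel phi C phistar)
  (h3 : exists P : 'rV[R]_m -> R,
      [/\ continuous P,
          forall x0 u0,
            (superlevel phi C phistar `\` optimal_stationary f U phi phistar) x0 ->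
            U u0 -> P (f (x0, u0)) < P x0
        & forall x0 u0, superlevel phi C phistar x0 ->
            U u0 -> P (f (x0, u0)) <= P x0])
  (hopt : optimal_process f U phi zeta0 I uopt xopt) :
  ideal_cvg I xopt zetastar.

Proof.
have FF : ProperFilter (dual_filter I) by exact: dual_filter_proper.
case: hopt => popt Jopt; case: (popt) => x0 uU xf.
have [P [cP Plt Ple]] := h3.
(* The process of hypothesis (2) has value at least [phistar - e] for every [e > 0], by compactness
   of [C]; optimality passes this on to [xopt]. *)
have liminf_ge : (phistar%:E <= objective phi I xopt)%E.
  have [u [x [px clx]]] := h2.
  apply: le_trans (Jopt _ _ px); apply/lee_subgt0Pr => e e0.
  apply: ereal_sup_ubound; exists (phistar - e) => //=.
  have FC : (x @ dual_filter I) C := @filterE _ (dual_filter I) FF _ (hCtraj _ _ px).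
  have : (x @ dual_filter I) [set z | phistar - e < phi z].
    apply: (near_of_compact_cluster _ _ _ _ hC FC) => c _ clc.
    have [_ phic] := clx _ (cluster_ideal_cluster _ _ _ _ _ clc).
    apply: (hphi c _ (lt_nbhsr _)).
    by rewrite ltrBlDr (le_lt_trans phic)// ltrDl.
  move=> /(ideal_sub hI _); apply => n /= lt1 lt2.
  by have := lt_trans lt1 lt2; rewrite ltxx.
have FC : (xopt @ dual_filter I) C := @filterE _ (dual_filter I) FF _ (hCtraj _ _ popt).
pose K := cluster (xopt @ dual_filter I).
have KC : K `<=` C.
  rewrite /K clusterE => z /(_ _ FC); rewrite -(closure_id C).1//.
  exact: compact_closed (@norm_hausdorff _ _) hC.
have cK : compact K := subclosed_compact (closed_cluster _ _) hC KC.
have K0 : K !=set0 by have [a [_ Ka]] := hC _ _ FC; exists a.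
have KD : K `<=` superlevel phi C phistar.
  move=> a Ka; split; [exact: KC | rewrite leNgt; apply/negP => phia].
  (* A level [y] above [phi a] separates: [phi] is at least [y] along the filter, but below [y] near
     the cluster point [a]. *)
  have /ereal_sup_gt[_ [y Iy <-]] : ((phi a)%:E < objective phi I xopt)%E.
    by apply: lt_le_trans liminf_ge; rewrite lte_fin.
  rewrite lte_fin => ay.
  have Fy : (xopt @ dual_filter I) [set z | y <= phi z].
    apply: (ideal_sub hI) Iy => n /= /negP; by rewrite -ltNge.
  have [z [/= yz zy]] := Ka _ _ Fy (hphi a _ (lt_nbhsl ay)).
  by move: zy; rewrite ltNge yz.
(* Tracking states and controls jointly lets compactness of [C]*[U] supply a control: lifting a
   point of [K] through [fst] yields a successor, through [f] a predecessor. *)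
pose w n := (xopt n, uopt n).
have cCU : compact (C `*` U) by exact: compact_setX.
have FCU : (w @ dual_filter I) (C `*` U).
  apply: (@filterE _ (dual_filter I)) => n.
  by split; [exact: (hCtraj _ _ popt) | exact: uU].
(* Here translation invariance enters: [f \o w] is [xopt] shifted by one. *)
have fw : f @ (w @ dual_filter I) = xopt @ dual_filter I.
  rewrite -(fmap_dual_filterS _ hI _ xopt hIinv).
  by have -> : (fun n => xopt n.+1) = f \o w by apply/funext => n; exact: xf.
have clw a u : cluster (w @ dual_filter I) (a, u) -> K a.
  move=> clau A V FA aV.
  by have [z []] := clau (fst @^-1` A) _ FA (cvg_fst aV); exists z.1.
have clfw a u : cluster (w @ dual_filter I) (a, u) -> K (f (a, u)).
  rewrite /K -fw => clau A V FA fV.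
  by have [z []] := clau (f @^-1` A) _ FA (hf _ _ fV); exists (f z).
have stepK a u : K a -> U u -> P a <= P (f (a, u)) -> a = zetastar.
  move=> Ka Uu Pa; suff : [set zetastar] a by [].
  rewrite -h1; apply: contrapT => na.
  by have := Plt a u (conj (KD _ Ka) na) Uu; rewrite ltNge Pa.
have succK a : K a -> exists2 u, U u & K (f (a, u)).
  move=> Ka.
  have [[c u] [[/= _ Uu] clcu ca]] := cluster_image_lift _ _ _ _ fst _
    (@norm_hausdorff _ _) (fun=> cvg_fst) cCU FCU Ka.
  by rewrite -ca; exists u => //; exact: clfw clcu.
have predK b : K b -> exists a u, [/\ K a, U u & f (a, u) = b].
  rewrite /K -{1}fw => clb.
  have [[a u] [[/= _ Uu] clau fau]] :=
    cluster_image_lift _ _ _ _ _ _ (@norm_hausdorff _ _) hf cCU FCU clb.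
  by exists a, u; split => //; exact: clw clau.
have cPK : {within K, continuous P} by exact: continuous_subspaceT.
have [a /set_mem Ka Pmin] := compact_EVT_min K0 cK cPK.
have [b /set_mem Kb Pmax] := compact_EVT_max K0 cK cPK.
have [u Uu Kfa] := succK _ Ka.
have az : a = zetastar := stepK _ _ Ka Uu (Pmin _ (mem_set Kfa)).
have [c [v [Kc Uv fc]]] := predK _ Kb.
have cz : c = zetastar.
  by apply: (stepK _ _ Kc Uv); rewrite fc; exact: Pmax (mem_set Kc).
(* Since [a] and [c] are both [zetastar], the maximum [P b = P (f (c, v))] is at most [P c = P a],
   the minimum. *)
have Pab : P b <= P a by rewrite -fc az -cz; exact: Ple (KD _ Kc) Uv.
have Kz d : K d -> d = zetastar.
  move=> Kd; have [u' Uu' Kfd] := succK _ Kd.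
  apply: (stepK _ _ Kd Uu'); apply: le_trans (Pmax _ (mem_set Kd)) _.
  exact: le_trans Pab (Pmin _ (mem_set Kfd)).
move=> e e0.
(* In the compact set [C], a single cluster point forces convergence to it. *)
have : (xopt @ dual_filter I) [set v | euclidean_norm (v - zetastar) < e].
  apply: (near_of_compact_cluster _ _ _ _ hC FC) => d _ Kd.
  by rewrite (Kz d Kd); exact: nbhs_euclidean_ball.
by move=> /(ideal_sub hI _); apply => n /= le1; apply/negP; rewrite -leNgt.
Qed.
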